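(* Let $A(m,n)\in l^\infty_ml^1_n\cap l^\infty_nl^1_m$ satisfy $A(m,n)=0\Leftrightarrow A(n,m)=0$ and $A(m,n)\ge0$ when $m\ne n$, and suppose that $A$ is either symmetric, or in Pauli form, i.e. $A(n,m)=\exp\big(\frac{\omega(m)-\omega(n)}{\Theta}\big)A(m,n)$ for a bounded real sequence $(\omega(n))_n$ and a fixed $\Theta>0$. Suppose that there exists a minimal $A_\sharp$-stable subspace $E$ of $l^1$ generated by an infinite number of basis vectors $e_n$, $n\in L$. Then, for any initial datum $\rho(0)$ with non-vanishing component in $E$, there is no equilibrium state $\underline{\rho}\in l^1\cap\mathrm{Ker}\,A_\sharp$ with the same trace as $\rho(0)$ in $E$, i.e. with $\sum_{n\in L}\underline{\rho}(n)=\sum_{n\in L}\rho(0,n)$.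
   Context: $l^1=l^1(\mathbb{N})$ with canonical basis $(e_n)$. $A\in l^\infty_ml^1_n\cap l^\infty_nl^1_m$ means $\sup_m\sum_n|A(m,n)|+\sup_n\sum_m|A(m,n)|<\infty$. $A_\sharp$ is the bounded operator on $l^1$ with matrix entries $A_\sharp(n,k)=A(k,n)$ if $n\ne k$, $A_\sharp(n,n)=-\sum_{m\ne n}A(n,m)$. The subspace generated by $\{e_n: n\in L\}$ is the closed subspace of $l^1$ of sequences supported in $L$; it is minimal $A_\sharp$-stable if it is non-zero, stable by $A_\sharp$, and contains no strictly smaller non-zero $A_\sharp$-stable subspace of the same form (generated by basis vectors). An initial datum is a diagonal one, identified with a sequence $\rho(0)=(\rho(0,n))_n\in l^1$ with $\rho(0,n)\ge0$ for all $n$; its component in $E$ is $(\rho(0,n))_{n\in L}$. An equilibrium state is an element of the kernel of $A_\sharp$. *)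

(* Defs.v *)
From mathcomp Require Import all_boot all_order all_algebra.
From mathcomp Require Import all_classical all_reals all_analysis.
Set Implicit Arguments.
Unset Strict Implicit.
Unset Printing Implicit Defensive.
Import Order.TTheory GRing.Theory Num.Theory.
Import numFieldNormedType.Exports.
Local Open Scope classical_set_scope.
Local Open Scope ring_scope.

Definition l1_norm (R : realType) (u : nat -> R) : \bar R :=
  (\sum_(0 <= n <oo) `|u n|%:E)%E.

Definition l1 (R : realType) : set (nat -> R) :=
  [set u | (l1_norm u < +oo)%E].

Definition linf_l1 (R : realType) (A : nat -> nat -> R) : Prop :=
  (ereal_sup (range (fun m => l1_norm (fun n => A m n))) +
   ereal_sup (range (fun n => l1_norm (fun m => A m n))) < +oo)%E.

Definition symmetric_coef (R : realType) (A : nat -> nat -> R) : Prop :=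
  forall m n, A m n = A n m.

Definition pauli_form (R : realType) (A : nat -> nat -> R) : Prop :=
  exists (omega : nat -> R) (Theta : R),
    [/\ bounded_fun omega, 0 < Theta &
        forall n m, A n m = expR ((omega m - omega n) / Theta) * A m n].

(* [limn] returns a default value on divergent sequences; when [linf_l1 A] and
   [l1 u] hold, the series in [sharp_mx], [sharp] and [trace_in] all converge
   absolutely. *)
Definition sharp_mx (R : realType) (A : nat -> nat -> R) (n k : nat) : R :=
  if n == k then - limn (series (fun m => if m == n then 0 else A n m))
  else A k n.

Definition sharp (R : realType) (A : nat -> nat -> R) (u : nat -> R)
  : nat -> R := fun n => limn (series (fun k => sharp_mx A n k * u k)).

(* The closed subspace of l^1 generated by the e_n, n in L. *)
Definition basis_span (R : realType) (L : set nat) : set (nat -> R) :=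
  [set u : nat -> R | l1 u /\ forall n, ~ L n -> u n = 0].

Arguments basis_span : clear implicits.

Definition sharp_stable (R : realType) (A : nat -> nat -> R)
    (E : set (nat -> R)) : Prop :=
  forall u, E u -> E (sharp A u).

Definition nonzero_space (R : realType) (E : set (nat -> R)) : Prop :=
  exists2 u, E u & u <> (fun=> 0).

(* Minimality among the stable subspaces generated by basis vectors only. *)
Definition minimal_sharp_stable (R : realType) (A : nat -> nat -> R)
    (E : set (nat -> R)) : Prop :=
  [/\ nonzero_space E, sharp_stable A E &
      forall L' : set nat,
        nonzero_space (basis_span R L') -> sharp_stable A (basis_span R L') ->
        ~ (basis_span R L' `<` E)].

Definition component (R : realType) (L : set nat) (u : nat -> R) : nat -> R :=
  fun n => if n \in L then u n else 0.

Definition trace_in (R : realType) (L : set nat) (u : nat -> R) : R :=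
  limn (series (component L u)).

Definition initial_datum (R : realType) (rho0 : nat -> R) : Prop :=
  l1 rho0 /\ forall n, 0 <= rho0 n.

Definition equilibrium (R : realType) (A : nat -> nat -> R) (rho : nat -> R)
  : Prop := l1 rho /\ sharp A rho = (fun=> 0).

(* Main.v *)
Require Import Defs.
From mathcomp Require Import all_boot all_order all_algebra.
From mathcomp Require Import all_classical all_reals all_analysis.
Set Implicit Arguments.
Unset Strict Implicit.
Unset Printing Implicit Defensive.
Import Order.TTheory GRing.Theory Num.Theory.
Import numFieldNormedType.Exports.
Local Open Scope classical_set_scope.
Local Open Scope ring_scope.

(** The operator [sharp A] is the generator of a Markov jump process with rates
    [A n k] from [n] to [k], and both hypotheses on the form of [A] say that
    this process is reversible: there is a positive weight [w], equal to [1] in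
    the symmetric case and to [exp (omega / Theta)] in the Pauli case, with
    [A k n * w k = A n k * w n] ([detailed_balance]).  Hence [(sharp A rho) n]
    is the sum over [k] of [A n k * w n * (v k - v n)], where [v = rho / w], and
    an equilibrium is the same thing as a function [v] that is harmonic for
    symmetric nonnegative conductances ([sharp_flux]).

    Suppose that [rho] is an equilibrium with the trace of [rho0] in [E].  This
    trace is positive, so [v] is positive somewhere on [L].  As [w] is bounded
    away from zero and [rho] is summable, [v] tends to zero; its maximum over
    [L] is therefore attained, and attained only on a finite set [M].  Stability
    of [E] forbids jumps out of [L], so the maximum principle applies at each
    point of [M]: every neighbour of a maximum point is a maximum point
    ([maximum_principle]).  No jump leaves [M], so the span of [M] is stable
    ([sharp_stable_basis_span]).  It is non-zero and, [L] being infinite,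
    strictly smaller than [E], against minimality. *)

(** * Summable sequences *)

Lemma l1P (R : realType) (u : nat -> R) : l1 u <-> cvgn [normed series u].
Proof.
have nd : nondecreasing_seq [normed series u].
  by apply: (@nondecreasing_series _ (fun n => `|u n|) predT) => n _ _.
split=> [ul1|cu].
  apply: nondecreasing_is_cvgn => //.
  have ge0 : (0 <= l1_norm u)%E by apply: nneseries_ge0 => n _ _; rewrite lee_fin.
  exists (fine (l1_norm u)) => _ [n _ <-].
  rewrite -lee_fin fineK; last by rewrite ge0_fin_numE.
  rewrite /normed_series_of /series /= -sumEFin.
  by apply: nneseries_lim_ge => k _ _; rewrite lee_fin.
rewrite /l1 /= /l1_norm.
under eq_fun do rewrite sumEFin.
by rewrite (@EFin_lim _ [normed series u]) // ltry.
Qed.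

Lemma l1_is_cvg_series (R : realType) (u : nat -> R) : l1 u -> cvgn (series u).
Proof. by move=> /l1P /normed_cvg. Qed.

Lemma l1_cvg0 (R : realType) (u : nat -> R) : l1 u -> u @ \oo --> (0 : R).
Proof. by move=> /l1_is_cvg_series /cvg_series_cvg_0. Qed.

Lemma l1_dominated (R : realType) (C : R) (u v : nat -> R) :
  l1 u -> (forall n, `|v n| <= C * `|u n|) -> l1 v.
Proof.
move=> /l1P cu vu; apply/l1P.
apply: (@series_le_cvg _ _ (C *: (fun n => `|u n|))) => [n|n|n|].
- exact: normr_ge0.
- exact: le_trans (normr_ge0 _) (vu n).
- exact: vu.
- exact: is_cvg_seriesZ.
Qed.

Lemma l1_eventually0 (R : realType) (N : nat) (u : nat -> R) :
  (forall n, (N <= n)%N -> u n = 0) -> l1 u.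
Proof.
move=> u0; apply/l1P; apply: (cvgP ([normed series u] N)).
apply: cvg_near_cst; exists N => // n /= Nn.
rewrite /normed_series_of /series /= (@big_cat_nat _ _ _ N) //=.
rewrite [X in _ + X]big_nat_cond [X in _ + X]big1 ?addr0 // => k.
by rewrite andbT => /andP[/u0 -> _]; rewrite normr0.
Qed.

Lemma cvg_series_single (R : realType) (n : nat) (f : nat -> R) :
  (forall k, k != n -> f k = 0) -> series f @ \oo --> f n.
Proof.
move=> f0; apply: cvg_near_cst; exists n.+1 => // N /= nN.
rewrite /series /= big_mkord (bigD1 (Ordinal nN)) //= big1 ?addr0 // => k kn.
by apply: f0; apply: contraNneq kn => kn; apply/eqP/val_inj.
Qed.

Lemma ge0_series_cvg0 (R : realType) (f : nat -> R) :
  (forall k, 0 <= f k) -> series f @ \oo --> (0 : R) -> forall k, f k = 0.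
Proof.
move=> f0 cf k; apply/eqP; rewrite eq_le f0 andbT.
have nd : nondecreasing_seq (series f).
  by apply: (@nondecreasing_series _ f predT) => n _ _.
have := nondecreasing_cvgn_le nd (cvgP _ cf) k.+1.
rewrite (cvg_lim _ cf) // seriesS; apply: le_trans.
by rewrite lerDl; apply: sumr_ge0.
Qed.

Lemma bounded_fun_le (R : realType) (T : Type) (f : T -> R) :
  bounded_fun f -> exists B : R, forall x, `|f x| <= B.
Proof.
by move=> [K [_ hK]]; exists (K + 1) => x; apply: hK; rewrite ?ltrDl.
Qed.

Lemma linf_l1_row (R : realType) (A : nat -> nat -> R) (m : nat) :
  linf_l1 A -> l1 (A m).
Proof.
rewrite /linf_l1 /l1 /= => /(le_lt_trans _); apply.
apply: (@le_trans _ _ (ereal_sup (range (fun m => l1_norm (fun n => A m n))))).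
  by apply: ereal_sup_ubound; exists m.
rewrite leeDl //.
apply: (@le_trans _ _ (l1_norm (fun m => A m 0%N))).
  by apply: nneseries_ge0 => n _ _; rewrite lee_fin.
by apply: ereal_sup_ubound; exists 0%N.
Qed.

Lemma linf_l1_tr (R : realType) (A : nat -> nat -> R) :
  linf_l1 A -> linf_l1 (fun m n => A n m).
Proof. by rewrite /linf_l1 addeC. Qed.

(** * The flux form of the operator and its invariant subspaces *)

(** The diagonal entry of [sharp_mx] is minus the total jump rate out of [n].
    Distributing it over the targets [k] turns row [n] into the sum of the net
    fluxes from [k] to [n], the term [k = n] cancelling.  This regrouping is
    legitimate because both series converge absolutely. *)
Lemma sharp_flux (R : realType) (A : nat -> nat -> R) (rho : nat -> R)
    (n : nat) :
  linf_l1 A -> l1 rho ->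
  series (fun k => A k n * rho k - A n k * rho n) @ \oo --> sharp A rho n.
Proof.
move=> hA hrho; set f := fun k => _.
have /l1_is_cvg_series cf : l1 f.
  have hrow := linf_l1_row n hA; have hcol := linf_l1_row n (linf_l1_tr hA).
  (* summable sequences are bounded, and their products are summable *)
  have [B rhoB] : exists B : R, forall k, `|rho k| <= B.
    have /cvg_seq_bounded bnd : cvgn rho by apply: cvgP; exact: l1_cvg0.
    exact: bounded_fun_le.
  have h1 : l1 (fun k => A k n * rho k).
    apply: (l1_dominated (C := B) hcol) => k.
    by rewrite normrM mulrC ler_wpM2r.
  have h2 : l1 (fun k => - (A n k * rho n)).
    apply: (l1_dominated (C := `|rho n|) hrow) => k.
    by rewrite normrN normrM mulrC.
  apply/l1P.
  apply: (@series_le_cvg _ _ ((fun k => `|A k n * rho k|) +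
    (fun k => `|- (A n k * rho n)|))) => [k|k|k|].
  - exact: normr_ge0.
  - exact: addr_ge0.
  - exact: ler_normD.
  - by apply: is_cvg_seriesD; apply/l1P.
pose a k := if k == n then 0 else A n k.
have /l1_is_cvg_series ca : l1 a.
  apply: (l1_dominated (C := 1) (linf_l1_row n hA)) => k.
  by rewrite mul1r /a; case: eqP => // _; rewrite normr0.
pose D := limn (series a).
pose d k := if k == n then D * rho n else 0.
have cd : series d @ \oo --> D * rho n.
  have -> : D * rho n = d n by rewrite /d eqxx.
  by apply: cvg_series_single => k /negbTE; rewrite /d => ->.
have crho : series (rho n *: a) @ \oo --> D * rho n.
  rewrite (_ : D * rho n = limn (series (rho n *: a))).
    exact: is_cvg_seriesZ.
  by rewrite lim_seriesZ // mulrC.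
have -> : sharp A rho n = limn (series f).
  rewrite /sharp.
  have -> : (fun k => sharp_mx A n k * rho k) = f + (rho n *: a - d).
    apply/funext => k.
    rewrite /sharp_mx /f /= !fctE /a /d -/D [n == k]eq_sym.
    have [->|kn] := eqVneq k n.
      by rewrite subrr scaler0 !add0r mulNr.
    by rewrite subr0 /GRing.scale /= [rho n * _]mulrC subrK.
  apply: cvg_lim => //; rewrite seriesD -[limn _]addr0.
  apply: cvgD => //.
  rewrite -[X in _ --> X](subrr (D * rho n)) seriesD seriesN.
  exact: cvgB.
exact: cf.
Qed.

Lemma basis_vector_span (R : realType) (L : set nat) (n : nat) :
  L n -> basis_span R L (fun k => (k == n)%:R).
Proof.
move=> Ln; split=> [|k Lk]; last by case: eqP => // kn; case: Lk; rewrite kn.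
by apply: (@l1_eventually0 _ n.+1) => k nk; rewrite gtn_eqF.
Qed.

Lemma nonzero_basis_span (R : realType) (L : set nat) (n : nat) :
  L n -> nonzero_space (basis_span R L).
Proof.
move=> Ln; exists (fun k => (k == n)%:R); first exact: basis_vector_span.
by move=> /(congr1 (@^~ n)); rewrite eqxx => /eqP; rewrite oner_eq0.
Qed.

Lemma basis_span_proper (R : realType) (M L : set nat) :
  M `<` L -> basis_span R M `<` basis_span R L.
Proof.
move=> [ML LM]; split=> [u [ul1 u0]|sLM]; first by split=> // n Ln; apply: u0 => /ML.
apply: LM => n Ln; apply: contrapT => Mn.
have [_ /(_ _ Mn) /eqP] := sLM _ (basis_vector_span R Ln).
by rewrite eqxx oner_eq0.
Qed.

(** The component of [sharp A e_n] along [e_k] is the jump rate from [n] to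
    [k]. *)
Lemma sharp_stable_rate0 (R : realType) (A : nat -> nat -> R) (L : set nat)
    (n k : nat) :
  sharp_stable A (basis_span R L) -> L n -> ~ L k -> A n k = 0.
Proof.
move=> st Ln Lk.
have [_ /(_ _ Lk)] := st _ (basis_vector_span R Ln).
rewrite /sharp (cvg_lim _ (@cvg_series_single _ n _ _)) //.
  rewrite eqxx mulr1 /sharp_mx; case: eqP => // kn.
  by case: Lk; rewrite kn.
by move=> j /negbTE ->; rewrite mulr0.
Qed.

(** Boundedness of [M] makes the summability of [sharp A u] automatic. *)
Lemma sharp_stable_basis_span (R : realType) (A : nat -> nat -> R)
    (M : set nat) (N : nat) :
  (forall n, M n -> (n < N)%N) ->
  (forall n k, M n -> ~ M k -> A n k = 0) ->
  sharp_stable A (basis_span R M).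
Proof.
move=> MN MA u [_ u0].
have su0 k : ~ M k -> sharp A u k = 0.
  move=> Mk; have term0 j : sharp_mx A k j * u j = 0.
    have [Mj|/u0 ->] := pselect (M j); last by rewrite mulr0.
    rewrite /sharp_mx; case: eqP => [kj|_]; first by case: Mk; rewrite kj.
    by rewrite (MA j k) ?mul0r.
  rewrite /sharp (cvg_lim _ (@cvg_series_single _ 0%N _ _)) //.
split=> //; apply: (@l1_eventually0 _ N) => k Nk.
by apply: su0 => /MN; rewrite ltnNge Nk.
Qed.

(** * Reversibility and the maximum principle *)

(** The lower bound [c] is what makes [rho / w] summable along with [rho]. *)
Lemma detailed_balance (R : realType) (A : nat -> nat -> R) :
  symmetric_coef A \/ pauli_form A ->
  exists (w : nat -> R) (c : R),
    [/\ 0 < c, forall n, c <= w n & forall k n, A k n * w k = A n k * w n].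
Proof.
move=> [sA|[omega [T [bomega T0 pA]]]].
  by exists (fun=> 1), 1; split=> // k n; rewrite sA.
have [K hK] := bounded_fun_le bomega.
exists (fun n => expR (omega n / T)), (expR (- K / T)).
split=> [|n|k n]; first exact: expR_gt0.
  rewrite ler_expR ler_pM2r ?invr_gt0 //.
  by have := hK n; rewrite ler_norml => /andP[].
rewrite (pA k n) mulrAC -expRD -mulrDl subrK.
exact: mulrC.
Qed.

(** At a maximum point [n] of [v = rho / w] among its neighbours, all the terms
    [A n k * w n * (v n - v k)] of the flux balance are nonnegative, and they
    sum to zero. *)
Lemma maximum_principle (R : realType) (A : nat -> nat -> R) (w rho : nat -> R)
    (n : nat) :
  linf_l1 A -> l1 rho ->
  (forall m k, m <> k -> 0 <= A m k) ->
  (forall k, 0 < w k) -> (forall k m, A k m * w k = A m k * w m) ->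
  sharp A rho n = 0 ->
  (forall k, A n k != 0 -> rho k / w k <= rho n / w n) ->
  forall k, A n k != 0 -> rho k / w k = rho n / w n.
Proof.
move=> hA hrho hpos w0 bal eq0 vmax k Ank.
have [->//|kn] := eqVneq k n.
pose f j := A n j * rho n - A j n * rho j.
have fE j : f j = A n j * w n * (rho n / w n - rho j / w j).
  have wE i : rho i = w i * (rho i / w i).
    by rewrite mulrCA divff ?mulr1 // gt_eqF.
  by rewrite mulrBr -{2}bal -!mulrA -!wE.
have f0 j : 0 <= f j.
  rewrite fE; have [->|Anj] := eqVneq (A n j) 0; first by rewrite !mul0r.
  have [->|jn] := eqVneq j n; first by rewrite subrr mulr0.
  apply: mulr_ge0; last by rewrite subr_ge0 vmax.
  apply: mulr_ge0; last exact: ltW.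
  by apply: hpos; apply/eqP; rewrite eq_sym.
have cf : series f @ \oo --> (0 : R).
  have -> : f = - (fun j => A j n * rho j - A n j * rho n).
    by apply/funext => j; rewrite !fctE opprB.
  by rewrite seriesN -[X in _ --> X]oppr0 -eq0; apply: cvgN; exact: sharp_flux.
have /eqP := ge0_series_cvg0 f0 cf k.
rewrite fE !mulf_eq0 (negbTE Ank) gt_eqF //= subr_eq0.
by move=> /eqP.
Qed.

(** Beyond some rank [N] the values of [v] are below [v n0], so the maximum over
    [L] is that of a finite nonempty set of indices, and no index beyond [N]
    reaches it. *)
Lemma max_attained (R : realType) (v : nat -> R) (L : set nat) (n0 : nat) :
  v @ \oo --> (0 : R) -> L n0 -> 0 < v n0 ->
  exists n1 N, [/\ L n1, forall k, L k -> v k <= v n1 &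
                   forall k, v k = v n1 -> (k < N)%N].
Proof.
move=> cv Ln0 v0.
have [N _ hN] := @cvgr0_norm_lt _ _ _ _ _ _ cv _ v0.
have ltN k : (N <= k)%N -> v k < v n0.
  by move=> Nk; apply: le_lt_trans (ler_norm _) (hN k Nk).
have n0N : (n0 < N)%N by rewrite ltnNge; apply/negP => /ltN; rewrite ltxx.
case: (@arg_maxP _ _ _ (Ordinal n0N) (fun i : 'I_N => `[< L i >])
  (fun i : 'I_N => v i)) => [|i /asboolP Li vi]; first exact/asboolP.
have v0i : v n0 <= v i by apply: (vi (Ordinal n0N)); exact/asboolP.
exists i, N; split=> // [k Lk|k vk].
  case: (ltnP k N) => [kN|/ltN /ltW vk]; last exact: le_trans vk v0i.
  by apply: (vi (Ordinal kN)); exact/asboolP.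
by rewrite ltnNge; apply/negP => /ltN; rewrite vk ltNge v0i.
Qed.

(** * Traces *)

Lemma component_l1 (R : realType) (L : set nat) (u : nat -> R) :
  l1 u -> l1 (component L u).
Proof.
move=> hu; apply: (l1_dominated (C := 1) hu) => n.
by rewrite mul1r /component; case: ifP; rewrite ?normr0.
Qed.

Lemma trace_in_gt0 (R : realType) (L : set nat) (u : nat -> R) :
  initial_datum u -> component L u <> (fun=> 0) -> 0 < trace_in L u.
Proof.
move=> [hu u0] hc.
have c0 n : 0 <= component L u n by rewrite /component; case: ifP.
have cc := l1_is_cvg_series (component_l1 L hu).
rewrite lt_neqAle; apply/andP; split.
  apply: contra_not_neq hc => tr0; apply/funext.
  by apply: ge0_series_cvg0 => //; rewrite tr0.
apply: limr_ge => //; apply: nearW => n; exact: sumr_ge0.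
Qed.

Lemma trace_in_le0 (R : realType) (L : set nat) (u : nat -> R) :
  l1 u -> (forall n, L n -> u n <= 0) -> trace_in L u <= 0.
Proof.
move=> hu u0; apply: limr_le; first exact/l1_is_cvg_series/component_l1.
apply: nearW => n; apply: sumr_le0 => k _.
by rewrite /component; case: ifP => // /set_mem /u0.
Qed.

(** * Absence of equilibria *)

Theorem corollary16 (R : realType) (A : nat -> nat -> R)
    (hA : linf_l1 A)
    (hA0 : forall m n, A m n = 0 <-> A n m = 0)
    (hApos : forall m n, m <> n -> 0 <= A m n)
    (hAform : symmetric_coef A \/ pauli_form A)
    (L : set nat) (hL : infinite_set L)
    (hmin : minimal_sharp_stable A (basis_span R L))
    (rho0 : nat -> R) (hrho0 : initial_datum rho0)
    (hcomp : component L rho0 <> (fun=> 0)) :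
  ~ exists rho : nat -> R,
      equilibrium A rho /\ trace_in L rho = trace_in L rho0.
Proof.
move=> [rho [[hrho eq0] tr]].
have [_ stL minL] := hmin.
have [w [c [c0 cw bal]]] := detailed_balance hAform.
have w0 n : 0 < w n by apply: lt_le_trans (cw n).
pose v n := rho n / w n.
have [n0 [Ln0 v0]] : exists n0, L n0 /\ 0 < v n0.
  apply: contrapT => nex.
  have := trace_in_gt0 hrho0 hcomp; rewrite -tr ltNge trace_in_le0 // => n Ln.
  rewrite leNgt; apply/negP => rn; apply: nex; exists n; split=> //.
  by rewrite divr_gt0.
have cv : v @ \oo --> (0 : R).
  apply: l1_cvg0; apply: (l1_dominated (C := c^-1) hrho) => n.
  rewrite normrM mulrC ler_wpM2r // normfV gtr0_norm //.
  by rewrite lef_pV2 ?posrE.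
have [n1 [N [Ln1 vmax vN]]] := max_attained cv Ln0 v0.
pose M := [set n | L n /\ v n = v n1].
have MN n : M n -> (n < N)%N by move=> [_ /vN].
apply: (minL M); first by apply: (@nonzero_basis_span _ _ n1).
  apply: (sharp_stable_basis_span MN) => n k [Ln vn] Mk.
  have Lnb j : A n j != 0 -> L j.
    move=> Anj; apply: contrapT => Lj.
    by rewrite (sharp_stable_rate0 stL Ln Lj) eqxx in Anj.
  apply/eqP/negPn/negP => Ank; apply: Mk; split; first exact: Lnb.
  rewrite -vn; apply: (maximum_principle hA hrho hApos w0 bal) => //.
    by rewrite eq0.
  by move=> j /Lnb /vmax; rewrite -vn.
apply: basis_span_proper; split=> [n []//|LM]; apply: hL.
by apply: (@sub_finite_set _ _ `I_N) => [n /LM /MN//|]; exact: finite_II.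
Qed.
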